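(* Let $A\subset\mathbb{R}^n$ be a finite set (a finite set of states, embedded in $\mathbb{R}^n$ by a vector valued energy function $E:A\to\mathbb{R}^n$ and identified with its image, so that $E$ is the inclusion map). Let $Q\subset\mathbb{R}^n$ be the convex hull of $A$ and $Q^\circ$ the interior of $Q$. For $\beta$ in the dual space $\mathbb{R}^{n*}$ put $$Z(\beta)=\sum_{\omega\in A}e^{-(\beta,\omega)},\qquad p_\omega(\beta)=\frac{e^{-(\beta,\omega)}}{Z(\beta)}\quad(\omega\in A),\qquad \langle E\rangle(\beta)=\frac{\sum_{\omega\in A}\omega\cdot e^{-(\beta,\omega)}}{\sum_{\omega'\in A}e^{-(\beta,\omega')}}=-\nabla_\beta\log Z(\beta)\in\mathbb{R}^n,$$ and let $p(\beta)=(p_\omega(\beta))_{\omega\in A}$ be the Gibbs distribution, a probability distribution on $A$. Then: (a) The map $\langle E\rangle:\mathbb{R}^{n*}\to Q^\circ$, $\beta\mapsto\langle E\rangle(\beta)$, is a diffeomorphism. (b) For any $\overline{E}\in Q^\circ$ let $P_{\overline{E}}$ be the set of probability distributions $p=(p_\omega)_{\omega\in A}\in\Delta^A$ satisfying the constraints $$\langle E\rangle_p:=\sum_{\omega\in A}p_\omega\cdot\omega=\overline{E}.$$ Let $\beta(\overline{E})\in\mathbb{R}^{n*}$ be the unique element such that $\langle E\rangle(\beta(\overline{E}))=\overline{E}$. Then the Gibbs distribution $p(\beta(\overline{E}))$ has maximal entropy among all the distributions from $P_{\overline{E}}$. (c) Let $S(\overline{E})$ be the entropy of the distribution $p(\beta(\overline{E}))$.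 Then $\nabla_{\overline{E}}S(\overline{E})=\beta(\overline{E})$. (d) The functions $-\log Z(\beta)$ on $\mathbb{R}^{n*}$ and $S(\overline{E})$ on $Q^\circ\subset\mathbb{R}^n$ are concave and are the Legendre transforms of each other.
   Context: $\mathbb{R}^{n*}$ is the dual vector space of $\mathbb{R}^n$, and $(\beta,\omega)$ denotes the canonical pairing of $\beta\in\mathbb{R}^{n*}$ with $\omega\in\mathbb{R}^n$. For a finite set $A$, $\Delta^A$ denotes the simplex of all probability distributions on $A$, i.e. tuples $p=(p_\omega)_{\omega\in A}$ with $p_\omega\ge 0$ and $\sum_{\omega\in A}p_\omega=1$. The entropy of $p\in\Delta^A$ is $S(p)=-\sum_{\omega\in A}p_\omega\log p_\omega$ (with $0\log 0=0$). The gradients $\nabla_\beta$ and $\nabla_{\overline{E}}$ of a function mean its differential, considered as a vector in the dual space (so $\nabla_\beta$ takes values in $\mathbb{R}^n$ and $\nabla_{\overline{E}}$ in $\mathbb{R}^{n*}$). The Legendre transform is meant in the form appropriate for concave functions: for a concave function $f$ on a convex subset $U$ of a finite-dimensional real vector space $V$, it is $f^*(y)=\inf_{x\in U}\bigl((y,x)-f(x)\bigr)$ for $y\in V^*$. Thus in (d) the assertion means $S(\overline{E})=\inf_{\beta\in\mathbb{R}^{n*}}\bigl((\beta,\overline{E})+\log Z(\beta)\bigr)$ for $\overline{E}\in Q^\circ$ and $-\log Z(\beta)=\inf_{\overline{E}\in Q^\circ}\bigl((\beta,\overline{E})-S(\overline{E})\bigr)$ for $\beta\in\mathbb{R}^{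n*}$.
   Formalization: The formal statement assumes that the interior of Q is nonempty (A affinely spans R^n); without it (a) is false, e.g. for n = 1 and A = {0}, where the interior of Q is empty. *)

(* Defs.v *)
From HB Require Import structures.
From mathcomp Require Import all_boot all_order all_algebra.
From mathcomp Require Import finmap.
From mathcomp Require Import all_classical all_reals all_analysis.

Set Implicit Arguments.
Unset Strict Implicit.
Unset Printing Implicit Defensive.

Import Order.TTheory GRing.Theory Num.Theory.
Import numFieldNormedType.Exports.

Local Open Scope classical_set_scope.
Local Open Scope ring_scope.

Section SmoothMaps.
Context {R : realType}.

(* On an open set U of the finite-dimensional domain 'M_(m, n), C^k.+1 amounts
   to differentiability with all directional derivatives of class C^k. *)
Fixpoint of_class_C (m n : nat) (W : normedModType R) (k : nat)
    (U : set 'M[R]_(m, n)) (f : 'M[R]_(m, n) -> W) : Prop :=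
  if k is k'.+1 then
    (forall x, U x -> differentiable f x) /\
    (forall v, of_class_C k' U (fun x => 'D_v f x))
  else forall x, U x -> {for x, continuous f}.

Definition smooth_on (m n : nat) (W : normedModType R)
    (U : set 'M[R]_(m, n)) (f : 'M[R]_(m, n) -> W) : Prop :=
  forall k, of_class_C k U f.

(* Meaningful for open sets U and U'. *)
Definition diffeomorphism (m n p q : nat)
    (U : set 'M[R]_(m, n)) (U' : set 'M[R]_(p, q))
    (f : 'M[R]_(m, n) -> 'M[R]_(p, q)) : Prop :=
  [/\ set_bij U U' f,
      smooth_on U f &
      exists2 g : 'M[R]_(p, q) -> 'M[R]_(m, n),
        {in U, cancel f g} & smooth_on U' g].

End SmoothMaps.

Section Convexity.
Context {R : realType}.

Definition convex_hull (M : lmodType R) (A : set M) : set M :=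
  smallest (@convex_set R M) A.

Definition concave_on (M : lmodType R) (U : set M) (f : M -> R) : Prop :=
  @convex_set R M U /\ @convex_function R M U (fun x => - f x).

(* [pair y x] is the value at the vector x of the linear form represented by
   y; the infimum is taken in the extended reals so that it always exists. *)
Definition concave_legendre (V D : Type) (pair : D -> V -> R)
    (U : set V) (f : V -> R) (y : D) : \bar R :=
  ereal_inf [set (pair y x - f x)%:E | x in U].

End Convexity.

Section Distributions.
Context {R : realType} {T : finType}.

Definition simplex : set (T -> R) :=
  [set p | (forall w, 0 <= p w) /\ \sum_(w : T) p w = 1].

(* The convention 0 log 0 = 0 holds because of the factor [p w]. *)
Definition entropy (p : T -> R) : R := - \sum_(w : T) p w * ln (p w).

End Distributions.

(* Vectors of R^n are columns; the dual space consists of rows. *)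
Section Gibbs.
Context {R : realType} {n : nat}.
Implicit Types (b : 'rV[R]_n) (x E : 'cV[R]_n) (A : {fset 'cV[R]_n}).

Definition pairing b x : R := (b *m x) 0 0.

(* A gradient is the differential seen as an element of the dual space; on
   the space of rows it is thus a column, and conversely. *)
Definition has_dual_gradient (f : 'rV[R]_n -> R) b x : Prop :=
  is_diff b f (fun v : 'rV[R]_n => pairing v x).

Definition has_gradient (f : 'cV[R]_n -> R) x b : Prop :=
  is_diff x f (fun v : 'cV[R]_n => pairing b v).

Definition polytope A : set 'cV[R]_n := convex_hull [set` A].

Definition partition_fun A b : R := \sum_(w : A) expR (- pairing b (val w)).

Definition gibbs A b : A -> R :=
  fun w => expR (- pairing b (val w)) / partition_fun A b.
Arguments gibbs A b : clear implicits.

Definition mean_energy A b : 'cV[R]_n :=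
  (partition_fun A b)^-1 *: \sum_(w : A) expR (- pairing b (val w)) *: val w.

Definition constrained A E : set (A -> R) :=
  [set p | simplex p /\ \sum_(w : A) p w *: val w = E].

(* Arbitrary value when the equation has no solution. *)
Definition beta_of A E : 'rV[R]_n := get [set b | mean_energy A b = E].

Definition entropy_at A E : R := entropy (gibbs A (beta_of A E)).

End Gibbs.

Arguments gibbs {R n} A b.

(* Main.v *)
Require Import Defs.
From HB Require Import structures.
From mathcomp Require Import all_boot all_order all_algebra.
From mathcomp Require Import finmap.
From mathcomp Require Import all_classical all_reals all_analysis.
From mathcomp Require Import ring lra.

(* With F = log Z, Jensen's inequality for exp gives, for c <> b,
     (b, <E>(b)) + F(b) < (c, <E>(b)) + F(c),
   the inequality being strict because A affinely spans R^n.  Injectivity of <E>,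
   concavity of - F and of S, both Legendre formulas and, by exchanging the two
   points, the gradients of F and S follow from it.  Surjectivity onto the interior
   of Q comes from minimizing (b, E) + F(b), which grows at least like t |b| when Q
   contains a ball of radius t around E; the same estimate makes the inverse map
   locally bounded, hence continuous.  The differential of <E> is minus the
   covariance form, which is definite, so the inverse map beta is differentiable,
   its differential at E being the inverse of the one of <E> at beta(E), and
   smoothness follows by bootstrapping. *)

Set Implicit Arguments.
Unset Strict Implicit.
Unset Printing Implicit Defensive.

Import Order.TTheory GRing.Theory Num.Theory.
Import numFieldNormedType.Exports.

Local Open Scope classical_set_scope.
Local Open Scope ring_scope.

(** * Differential calculus on matrix spaces *)

Lemma continuous_dist_lt (R : realType) (V W : normedModType R) (f : V -> W) x :
  (forall e, 0 < e -> \forall y \near x, `|f x - f y| < e) -> {for x, continuous f}.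
Proof. by move=> H; apply/cvgrPdist_lt. Qed.

Lemma compact_norm_le (R : realType) (n : nat) (r : R) :
  compact [set b : 'rV[R]_n | `|b| <= r].
Proof.
apply: bounded_closed_compact.
  by exists r; split; [exact: num_real|move=> x /ltW rx y /le_trans; apply].
have -> : [set b : 'rV[R]_n | `|b| <= r] = closed_ball_ Num.norm 0 r.
  by apply/funext => b; rewrite /closed_ball_/= sub0r normrN.
exact: closed_closed_ball_.
Qed.

Lemma is_diff_linear_epsP (R : realType) (V W : normedModType R)
    (f : V -> W) (df : {linear V -> W}) x : continuous df ->
  is_diff x f df <->
  forall e, 0 < e ->
    \forall y \near x, `|f y - f x - df (y - x)| <= e * `|y - x|.
Proof.
move=> dfc; split=> [H e e0|H].
  have fx : differentiable f x by exact: ex_diff.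
  have /diff_locally/eqaddoP/(_ _ e0) := fx.
  rewrite diff_val [X in X -> _](near_shift x) sub0r => K; near=> y.
  have : `|(f \o shift x - (cst (f x) + df)) (y - x)| <= e * `|y - x|.
    by near: y.
  by rewrite !fctE /= subrK opprD addrA.
have Hd : f \o shift x = cst (f x) + df +o_ 0 id.
  apply/eqaddoP => e e0; rewrite [\forall x \near _, _ <= _](near_shift x) sub0r; near=> y.
  have : `|f y - f x - df (y - x)| <= e * `|y - x| by near: y; exact: H.
  by rewrite !fctE /= subrK opprD addrA.
have dE := diff_unique dfc Hd.
by split; [apply/diff_locallyP; rewrite dE|rewrite dE].
Unshelve. all: by end_near. Qed.

Section MatrixCalculus.
Context {R : realType} {m n : nat}.
Implicit Types (W : normedModType R) (x v : 'M[R]_(m, n)).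

(** Finite dimension enters here: expanded along the matrix units, a linear map is a finite sum of
    coordinates times fixed vectors. Hence [is_diff_epsP] asks only for linearity of the candidate
    differential. *)
Lemma linear_mx_continuous W (f : {linear 'M[R]_(m, n) -> W}) : continuous f.
Proof.
have fE : f = (fun y => \sum_i \sum_j y i j *: f (delta_mx i j)) :> (_ -> _).
  apply/funext => y; rewrite [in LHS](matrix_sum_delta y) linear_sum.
  by apply: eq_bigr => i _; rewrite linear_sum; apply: eq_bigr => j _; rewrite linearZ.
rewrite fE.
apply: (continuous_big add_continuous) => i _.
apply: (continuous_big add_continuous) => j _ x.
exact/(@cvgZr_tmp _ _ _ (nbhs x) _ (fun y => y i j))/coord_continuous.
Qed.

Lemma linear_mx_lipschitz W (f : {linear 'M[R]_(m, n) -> W}) :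
  exists2 k, 0 < k & forall x, `|f x| <= k * `|x|.
Proof. exact/linear_lipschitz/linear_mx_continuous. Qed.

Lemma is_diff_epsP W (f df : 'M[R]_(m, n) -> W) x : linear df ->
  is_diff x f df <->
  forall e, 0 < e ->
    \forall y \near x, `|f y - f x - df (y - x)| <= e * `|y - x|.
Proof.
move=> dflin.
pose dfM := GRing.isLinear.Build _ _ _ _ _ dflin.
pose dfL : {linear _ -> _} := HB.pack df dfM.
exact/(@is_diff_linear_epsP _ _ _ f dfL)/linear_mx_continuous.
Qed.

Lemma derive_linear W (f : 'M[R]_(m, n) -> W) x v :
  linear f -> differentiable f x /\ 'D_v f x = f v.
Proof.
move=> fL; pose fM := GRing.isLinear.Build _ _ _ _ _ fL.
pose F : {linear _ -> _} := HB.pack f fM.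
have Fc : continuous F := @linear_mx_continuous _ F.
have dF : differentiable f x by exact: (@linear_differentiable _ _ _ F x Fc).
by split=> //; rewrite deriveE// (diff_lin _ Fc).
Qed.

Lemma derive_scale W (f : 'M[R]_(m, n) -> R^o) (w : W) x v :
  differentiable f x ->
  differentiable (fun y => f y *: w) x /\
  'D_v (fun y => f y *: w) x = 'D_v f x *: w.
Proof.
move=> df; have dfw : differentiable (fun y => f y *: w) x.
  exact: differentiableZl.
by split=> //; rewrite !deriveE// diffZl.
Qed.

Lemma derive_bigsum W (I : Type) (r : seq I) (f : I -> 'M[R]_(m, n) -> W) x v :
  (forall i, differentiable (f i) x) ->
  differentiable (fun y => \sum_(i <- r) f i y) x /\
  'D_v (fun y => \sum_(i <- r) f i y) x = \sum_(i <- r) 'D_v (f i) x.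
Proof.
move=> df; elim: r => [|i r [IHd IH]].
  under eq_fun do rewrite big_nil; rewrite big_nil derive_cst.
  by split; first exact: differentiable_cst.
under eq_fun do rewrite big_cons; split; first exact: differentiableD.
by rewrite deriveD ?IH ?big_cons//; exact: diff_derivable.
Qed.

Lemma derive_expR_comp (f : 'M[R]_(m, n) -> R^o) x v :
  differentiable f x ->
  differentiable (fun y => expR (f y) : R^o) x /\
  'D_v (fun y => expR (f y) : R^o) x = expR (f x) * 'D_v f x.
Proof.
move=> dfx; have dE (y : R^o) : differentiable (expR : R^o -> R^o) y.
  by apply/derivable1_diffP; exact: derivable_expR.
have d1E (y h : R^o) : 'd (expR : R^o -> R^o) y h = expR y * h.
  by rewrite diff1E// derive1E (@derive_val _ _ _ _ _ _ _ (is_derive_expR y)) mulrC.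
have dEf : differentiable (fun y => expR (f y) : R^o) x.
  exact: (@differentiable_comp _ _ _ _ f expR).
split=> //; rewrite !deriveE//.
have := diff_comp dfx (dE (f x)); rewrite /comp => ->.
exact: d1E.
Qed.

Lemma derive_delta W (f : 'M[R]_(m, n) -> W) x v :
  differentiable f x ->
  'D_v f x = \sum_i \sum_j v i j *: 'D_(delta_mx i j) f x.
Proof.
move=> df; rewrite deriveE// [in LHS](matrix_sum_delta v) linear_sum.
apply: eq_bigr => i _; rewrite linear_sum; apply: eq_bigr => j _.
by rewrite linearZ /= deriveE.
Qed.

Lemma near_eq_differentiable W (f g : 'M[R]_(m, n) -> W) x :
  (\near x, f x = g x) -> differentiable f x -> differentiable g x.
Proof.
move=> fg df; suff : is_diff x g ('d f x) by move=> ?; exact: ex_diff.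
have fxE := nbhs_singleton fg.
apply/(is_diff_epsP g x (linearP ('d f x))) => e e0.
have /(is_diff_epsP f x (linearP ('d f x)))/(_ _ e0) H := differentiableP df.
by near=> y; rewrite -fxE -(near fg y)//; near: y.
Unshelve. all: by end_near. Qed.

(** Serves for functions trapped between tangent planes at two points: the remainder is then
    controlled by the variation of the candidate gradient [G], and continuity of [G] alone makes it
    negligible against the distance. *)
Lemma is_diff_sandwich (D : normedModType R) (f df : 'M[R]_(m, n) -> R)
    (G : 'M[R]_(m, n) -> D) C x :
  linear (df : _ -> R^o) -> {for x, continuous G} ->
  (\forall y \near x,
     `|f y - f x - df (y - x)| <= C * `|G y - G x| * `|y - x|) ->
  is_diff x (f : _ -> R^o) df.
Proof.
move=> dfL cG H; apply/is_diff_epsP => // e e0.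
have C0 : 0 < `|C| + 1 by rewrite ltr_wpDl.
have /cvgrPdist_le/(_ (e / (`|C| + 1))) := cG.
rewrite divr_gt0// => /(_ isT) cG'.
near=> y.
apply: le_trans (_ : C * `|G y - G x| * `|y - x| <= _); first by near: y.
apply: ler_wpM2r => //.
have : `|G y - G x| <= e / (`|C| + 1) by rewrite distrC; near: y.
rewrite ler_pdivlMr// mulrC; apply: le_trans.
by rewrite ler_wpM2r// (le_trans (ler_norm C))// lerDl.
Unshelve. all: by end_near. Qed.

(** A direction with [df v < 0] would make [f] drop below its minimum at [x + s *: v] for small
    positive [s]; applying this to both signs of [v] gives zero. *)
Lemma is_diff_min (f df : 'M[R]_(m, n) -> R^o) x :
  is_diff x f df -> linear df -> (forall y, f x <= f y) -> forall v, df v = 0.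
Proof.
move=> Hf dfL fmin.
have df0 : df 0 = 0 by have := dfL (-1) 0 0; rewrite scaler0 addr0 scaleN1r addNr.
have dfZ a v : df (a *: v) = a *: df v by have := dfL a v 0; rewrite !addr0 df0 addr0.
suff H v : 0 <= df v.
  by move=> v; apply/le_anti; rewrite H andbT -oppr_ge0 -scaleN1r -dfZ H.
rewrite leNgt; apply/negP => dfv.
have v0 : 0 < `|v| + 1 by rewrite ltr_wpDl.
(* Chosen so that [e * |v| < - df v]: the error term cannot compensate the decrease. Adding 1 keeps
   the denominators positive, also in [s], which places [x + s *: v] in the ball of radius [r]. *)
pose e := - df v / (`|v| + 1).
have e0 : 0 < e by rewrite divr_gt0// oppr_gt0.
have /nbhs_normP[r /= r0 Hr] := (is_diff_epsP _ _ dfL).1 Hf _ e0.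
pose s := r / (`|v| + 1) / 2.
have s0 : 0 < s by rewrite !divr_gt0.
have := Hr (x + s *: v); rewrite /ball_/= opprD addrA subrr sub0r normrN.
rewrite normrZ (gtr0_norm s0) [x + _]addrC addrK => /(_ _)/wrap[].
  rewrite /s mulrAC ltr_pdivrMr// mulrAC ltr_pdivrMr//.
  by nra.
rewrite dfZ normrZ (gtr0_norm s0) ler_norml => /andP[_].
have ev : e * `|v| < - df v.
  by rewrite /e mulrAC ltr_pdivrMr// ltr_pM2l ?oppr_gt0// ltrDl.
rewrite -(ltr_pM2l s0) mulrCA in ev.
by have := fmin (s *: v + x); rewrite /GRing.scale/=; lra.
Qed.

End MatrixCalculus.

(** * Stability of the classes C^k *)

Lemma near_eq_continuous (T U : topologicalType) (f g : T -> U) x :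
  (\near x, f x = g x) -> {for x, continuous f} -> {for x, continuous g}.
Proof.
move=> fg cf; rewrite /prop_for /continuous_at -(nbhs_singleton fg).
exact: cvg_trans (near_eq_cvg fg) cf.
Qed.

Section OfClassC.
Context {R : realType} {m n : nat} {U : set 'M[R]_(m, n)}.
Hypothesis openU : open U.
Implicit Types (W : normedModType R) (k : nat).

Lemma open_near_eq (T : Type) (f g : 'M[R]_(m, n) -> T) x :
  (forall y, U y -> f y = g y) -> U x -> \near x, f x = g x.
Proof.
by move=> fg Ux; apply: filterS fg _; exact: open_nbhs_nbhs.
Qed.

(** Openness turns equality on [U] into equality near each of its points, so derivatives agree too.
    In the inductions below it replaces a derivative by a formula that holds only on [U]. *)
Lemma of_class_C_congr W k (f g : 'M[R]_(m, n) -> W) :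
  (forall x, U x -> f x = g x) -> of_class_C k U f -> of_class_C k U g.
Proof.
elim: k f g => [|k IH] f g fg /=.
  by move=> cf x Ux; apply: near_eq_continuous (cf x Ux); exact: open_near_eq.
move=> [df Df]; split.
  move=> x Ux; apply: near_eq_differentiable (df x Ux); exact: (open_near_eq fg Ux).
move=> v; apply: IH (Df v) => x Ux; apply: near_eq_derive; exact: (open_near_eq fg Ux).
Qed.

Lemma of_class_CS W k (f : 'M[R]_(m, n) -> W) :
  of_class_C k.+1 U f -> of_class_C k U f.
Proof.
elim: k f => [|k IH] f [df Df].
  by move=> x Ux; apply: differentiable_continuous; exact: df.
by split=> // v; exact: IH.
Qed.

Lemma of_class_C_cst W k (a : W) : of_class_C k U (fun=> a).
Proof.
elim: k a => [|k IH] a; first by move=> x _; exact: cst_continuous.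
split=> [x _|v]; first exact: differentiable_cst.
by under eq_fun do rewrite derive_cst; exact: IH.
Qed.

Lemma of_class_C_linear W k (f : 'M[R]_(m, n) -> W) :
  linear f -> of_class_C k U f.
Proof.
move=> fL; have df x v := derive_linear x v fL.
case: k => [|k]; last split=> [x _|v].
- by move=> x _; apply: differentiable_continuous; have [] := df x 0.
- by have [] := df x 0.
apply: of_class_C_congr (of_class_C_cst k (f v)) => x _.
by have [_ ->] := df x v.
Qed.

Lemma of_class_C_add W k (f g : 'M[R]_(m, n) -> W) :
  of_class_C k U f -> of_class_C k U g ->
  of_class_C k U (fun x => f x + g x).
Proof.
elim: k f g => [|k IH] f g.
  by move=> cf cg x Ux; apply: continuousD; [exact: cf|exact: cg].
move=> [df Df] [dg Dg]; split.
  by move=> x Ux; apply: differentiableD; [exact: df|exact: dg].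
move=> v; apply: of_class_C_congr (IH _ _ (Df v) (Dg v)) => x Ux.
by rewrite deriveD//; apply: diff_derivable; [exact: df|exact: dg].
Qed.

Lemma of_class_C_sum W k (I : Type) (r : seq I) (P : pred I)
    (f : I -> 'M[R]_(m, n) -> W) :
  (forall i, P i -> of_class_C k U (f i)) ->
  of_class_C k U (fun x => \sum_(i <- r | P i) f i x).
Proof.
move=> Cf; elim: r => [|i r IH].
  by under eq_fun do rewrite big_nil; exact: of_class_C_cst.
case Pi: (P i); under eq_fun do rewrite big_cons Pi; last by [].
by apply: of_class_C_add => //; exact: Cf.
Qed.

Lemma of_class_C_scale W k (f : 'M[R]_(m, n) -> R^o) (w : W) :
  of_class_C k U f -> of_class_C k U (fun x => f x *: w).
Proof.
elim: k f => [|k IH] f.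
  by move=> cf x Ux; apply: continuousZr_tmp; exact: cf.
move=> [df Df]; split=> [x Ux|v]; first by have [] := derive_scale w 0 (df x Ux).
apply: of_class_C_congr (IH _ (Df v)) => x Ux.
by have [_ ->] := derive_scale w v (df x Ux).
Qed.

(** The product rule brings back [f] and [g] themselves, which have to be lowered by one class with
    [of_class_CS] before the induction hypothesis applies. *)
Lemma of_class_C_mul k (f g : 'M[R]_(m, n) -> R^o) :
  of_class_C k U f -> of_class_C k U g ->
  of_class_C k U (fun x => (f x * g x : R^o)).
Proof.
elim: k f g => [|k IH] f g.
  by move=> cf cg x Ux; apply: continuousM; [exact: cf|exact: cg].
move=> Cf Cg; have [[df Df] [dg Dg]] := (Cf, Cg); split.
  by move=> x Ux; apply: differentiableM; [exact: df|exact: dg].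
move=> v; apply: of_class_C_congr (of_class_C_add
  (IH _ _ (of_class_CS Cf) (Dg v)) (IH _ _ (of_class_CS Cg) (Df v))) => x Ux.
by rewrite deriveM//; apply: diff_derivable; [exact: df|exact: dg].
Qed.

Lemma of_class_C_prod k (I : Type) (r : seq I) (P : pred I)
    (f : I -> 'M[R]_(m, n) -> R^o) :
  (forall i, P i -> of_class_C k U (f i)) ->
  of_class_C k U (fun x => \prod_(i <- r | P i) f i x : R^o).
Proof.
move=> Cf; elim: r => [|i r IH].
  by under eq_fun do rewrite big_nil; exact: of_class_C_cst.
case Pi: (P i); under eq_fun do rewrite big_cons Pi; last by [].
by apply: of_class_C_mul => //; exact: Cf.
Qed.

Lemma of_class_C_inv k (f : 'M[R]_(m, n) -> R^o) :
  (forall x, U x -> f x != 0) -> of_class_C k U f ->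
  of_class_C k U (fun x => (f x)^-1 : R^o).
Proof.
move=> f0; elim: k f f0 => [|k IH] f f0.
  by move=> cf x Ux; apply: continuousV; [exact: f0|exact: cf].
move=> Cf; have [df Df] := Cf; split.
  by move=> x Ux; apply: differentiableV; [exact: df|exact: f0].
move=> v; have CV := IH _ f0 (of_class_CS Cf).
have CN : of_class_C k U (fun=> -1 : R^o) by exact: of_class_C_cst.
apply: of_class_C_congr
  (of_class_C_mul CN (of_class_C_mul (of_class_C_mul CV CV) (Df v))) => x Ux.
rewrite deriveV; [|exact: f0|by apply: diff_derivable; exact: df].
by rewrite mulN1r -exprVn expr2 scaleNr.
Qed.

Lemma of_class_C_expR k (f : 'M[R]_(m, n) -> R^o) :
  of_class_C k U f -> of_class_C k U (fun x => expR (f x) : R^o).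
Proof.
elim: k f => [|k IH] f.
  move=> cf x Ux; apply: (@continuous_comp _ _ _ f expR).
    exact: cf.
  exact: continuous_expR.
move=> Cf; have [df Df] := Cf.
split=> [x Ux|v]; first by have [] := derive_expR_comp 0 (df x Ux).
apply: of_class_C_congr (of_class_C_mul (IH _ (of_class_CS Cf)) (Df v)) => x Ux.
by have [_ ->] := derive_expR_comp v (df x Ux).
Qed.

Lemma of_class_C_det k d (J : 'M[R]_(m, n) -> 'M[R]_d) :
  (forall i j, of_class_C k U (fun x => J x i j : R^o)) ->
  of_class_C k U (fun x => \det (J x) : R^o).
Proof.
move=> CJ; apply: of_class_C_sum => s _; apply: of_class_C_mul.
  exact: of_class_C_cst.
by apply: of_class_C_prod => i _; exact: CJ.
Qed.

(** Cramer's formula: each entry is a cofactor divided by the determinant, both polynomial in the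
    entries of [J x]. *)
Lemma of_class_C_invmx k d (J : 'M[R]_(m, n) -> 'M[R]_d) :
  (forall x, U x -> J x \in unitmx) ->
  (forall i j, of_class_C k U (fun x => J x i j : R^o)) ->
  forall i j, of_class_C k U (fun x => invmx (J x) i j : R^o).
Proof.
move=> uJ CJ i j.
have CV : of_class_C k U (fun x => (\det (J x))^-1 : R^o).
  apply: of_class_C_inv; last exact: of_class_C_det.
  by move=> x Ux; rewrite -unitfE -unitmxE uJ.
have CC : of_class_C k U (fun x => cofactor (J x) j i : R^o).
  apply: of_class_C_mul; first exact: of_class_C_cst.
  apply: of_class_C_det => a b.
  by under eq_fun do rewrite !mxE; exact: CJ.
apply: of_class_C_congr (of_class_C_mul CV CC) => x Ux.
by rewrite /invmx uJ// !mxE.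
Qed.

End OfClassC.

(** * Smoothness of inverse maps *)

Section SmoothInverse.
Context {R : realType}.

Lemma differentiable_linear_comp m n p q (f : 'M[R]_(m, n) -> 'M[R]_(p, q))
    (W : normedModType R) (L : {linear 'M[R]_(p, q) -> W}) x :
  differentiable f x -> is_diff x (L \o f) (L \o 'd f x).
Proof.
move=> df; have cL : continuous L := @linear_mx_continuous _ _ _ _ L.
have dL : differentiable L (f x) by exact: (@linear_differentiable _ _ _ L _ cL).
split; first exact: differentiable_comp.
by rewrite (diff_comp df dL) (diff_lin _ cL).
Qed.

Lemma of_class_C_linear_comp m n p q (U : set 'M[R]_(m, n)) k
    (f : 'M[R]_(m, n) -> 'M[R]_(p, q)) (W : normedModType R)
    (L : 'M[R]_(p, q) -> W) :
  open U -> linear L -> of_class_C k U f -> of_class_C k U (fun x => L (f x)).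
Proof.
move=> oU linL; pose LM := GRing.isLinear.Build _ _ _ _ _ linL.
pose LL : {linear _ -> _} := HB.pack L LM.
elim: k f => [|k IH] f.
  move=> cf x Ux; apply: (@continuous_comp _ _ _ f LL); first exact: cf.
  exact: linear_mx_continuous.
move=> [df Df]; split=> [x Ux|v].
  by have := differentiable_linear_comp LL (df x Ux) => ?; exact: ex_diff.
apply: (of_class_C_congr oU) (IH _ (Df v)) => x Ux.
have H := differentiable_linear_comp LL (df x Ux).
have dLf : differentiable (fun x => L (f x)) x by exact: ex_diff.
rewrite !deriveE//; last exact: df.
by have /(congr1 (@^~ v)) /= := @diff_val _ _ _ _ _ _ _ H.
Qed.

Lemma of_class_C_mx_entry m n p q (U : set 'M[R]_(m, n)) k
    (f : 'M[R]_(m, n) -> 'M[R]_(p, q)) i j :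
  open U -> of_class_C k U f -> of_class_C k U (fun x => f x i j : R^o).
Proof.
move=> oU; apply: (@of_class_C_linear_comp _ _ _ _ _ _ f R^o (fun y => y i j)) => //.
by move=> a x y; rewrite !mxE.
Qed.

(** The chain rule is written in coordinates so that [h] is differentiated only in the fixed
    directions [delta_mx i j]; these derivatives are of the lower class and the induction hypothesis
    covers their composites with [g]. *)
Lemma of_class_C_comp m n p q (U : set 'M[R]_(m, n)) (U' : set 'M[R]_(p, q)) k
    (g : 'M[R]_(m, n) -> 'M[R]_(p, q)) (h : 'M[R]_(p, q) -> R^o) :
  open U -> open U' -> (forall x, U x -> U' (g x)) ->
  of_class_C k U g -> of_class_C k U' h -> of_class_C k U (h \o g).
Proof.
move=> oU oU' gU; elim: k h => [|k IH] h.
  move=> cg ch x Ux; apply: (@continuous_comp _ _ _ g h); first exact: cg.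
  exact/ch/gU.
move=> Cg Ch; have [[dg Dg] [dh Dh]] := (Cg, Ch).
have dhg x : U x -> differentiable (h \o g) x.
  by move=> Ux; apply: differentiable_comp; [exact: dg|exact/dh/gU].
split=> // v.
have Cs : of_class_C k U (fun x => \sum_i \sum_j
    ('D_v g x i j * ('D_(delta_mx i j) h \o g) x) : R^o).
  apply: of_class_C_sum => // i _; apply: of_class_C_sum => // j _.
  apply: of_class_C_mul => //.
    by apply: of_class_C_mx_entry => //; exact: Dg.
  by apply: IH (Dh _); exact: (of_class_CS Cg).
apply: (of_class_C_congr oU) Cs => x Ux.
have [dgx dhx] := (dg x Ux, dh _ (gU x Ux)).
rewrite [RHS]deriveE; last exact: dhg.
rewrite (diff_comp dgx dhx) /= -(deriveE v dgx) -(deriveE _ dhx).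
by rewrite [RHS]derive_delta.
Qed.

(** * Smoothness of a continuous right inverse of a smooth map with injective differentials *)

Variables (n : nat) (f : 'rV[R]_n -> 'cV[R]_n) (g : 'cV[R]_n -> 'rV[R]_n).
Variable U' : set 'cV[R]_n.
Hypothesis oU' : open U'.
Hypothesis fsmooth : smooth_on [set: 'rV[R]_n] f.
Hypothesis Dfinj : forall b v, 'D_v f b = 0 -> v = 0.
Hypothesis gK : forall E, U' E -> f (g E) = E.
Hypothesis gcont : forall E, U' E -> {for E, continuous g}.

(** Jacobian matrix in row convention: row [i] is the derivative along the basis vector [i], so that
    a direction multiplies it from the left. *)
Let J b : 'M[R]_n := \matrix_(i, j) 'D_(delta_mx 0 i) f b j 0.

Let df b : differentiable f b.
Proof. by have [df _] := fsmooth 1; exact: df. Qed.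

Let DfE b v : 'D_v f b = (v *m J b)^T.
Proof.
rewrite derive_delta//; apply/matrixP => i j; rewrite big_ord1 !mxE summxE.
by apply: eq_bigr => l _; rewrite !mxE !ord1.
Qed.

(** Every row of the left kernel of [J b] is a direction along which the derivative vanishes, hence
    is zero by [Dfinj]. *)
Let J_unit b : J b \in unitmx.
Proof.
rewrite -row_free_unit -kermx_eq0; apply/eqP/row_matrixP => i; rewrite row0.
apply: (@Dfinj b); rewrite DfE -row_mul mulmx_ker row0.
by apply/matrixP => ? ?; rewrite !mxE.
Qed.

Let T b (v : 'cV[R]_n) : 'rV[R]_n := v^T *m invmx (J b).

Let linT b : linear (T b).
Proof. by move=> a u v; rewrite /T linearP/= mulmxDl -scalemxAl. Qed.

(** With [u = g y - g E], continuity of [g] lets the expansion of [f] at [g E] be evaluated at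
    [g y]. It says that [y - E] is the differential of [f] at [u] up to [eta * |u|]; applying the
    inverse differential [T] gives [u] up to [K * eta * |u|]. *)
Let diffg E : U' E -> is_diff E g (T (g E)).
Proof.
move=> UE; apply/is_diff_epsP; first exact: linT.
move=> e e0; set b0 := g E.
pose TM := GRing.isLinear.Build _ _ _ _ _ (@linT b0).
pose TL : {linear 'cV[R]_n -> 'rV[R]_n} := HB.pack (T b0) TM.
have [K K0 TK] : exists2 k, 0 < k & forall x, `|T b0 x| <= k * `|x|.
  exact: (linear_mx_lipschitz TL).
(* The first bound absorbs half of [|u|] and yields [|u| <= 2 * K * |y - E|]; with this, the second
   bound brings the error down to [e * |y - E|]. *)
pose eta := Num.min (2 * K)^-1 (e / (2 * K ^+ 2)).
have eta0 : 0 < eta.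
  by rewrite /eta lt_min invr_gt0 divr_gt0 ?mulr_gt0 ?exprn_gt0.
have /(is_diff_epsP _ _ (linearP ('d f b0))) H := differentiableP (df b0).
have {H} H : \forall b \near b0, `|f b - f b0 - 'D_(b - b0) f b0| <= eta * `|b - b0|.
  by apply: filterS (H _ eta0) => b; rewrite deriveE.
have {H} H := gcont UE H.
have oUE : \forall y \near E, U' y by exact: open_nbhs_nbhs.
have {H oUE} : \forall y \near E, U' y /\
    `|f (g y) - f b0 - 'D_(g y - b0) f b0| <= eta * `|g y - b0|.
  exact: filterI.
apply: filterS => y [Uy]; rewrite gK// /b0 (gK UE) -/b0 => H.
set u := g y - b0 in H *.
have Tu : T b0 ('D_u f b0) = u by rewrite DfE /T trmxK mulmxK.
have Hu : `|u - T b0 (y - E)| <= K * (eta * `|u|).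
  rewrite -{1}Tu distrC -[T b0 (y - E) - _](linearB TL) /=.
  by apply: le_trans (TK _) _; rewrite ler_pM2l.
have u2 : `|u| <= 2 * K * `|y - E|.
  have H1 : `|u| <= `|u - T b0 (y - E)| + `|T b0 (y - E)|.
    by rewrite -{1}(subrK (T b0 (y - E)) u) ler_normD.
  have H2 : K * (eta * `|u|) <= `|u| / 2.
    rewrite mulrA [leRHS]mulrC ler_wpM2r//.
    have : eta <= (2 * K)^-1 by rewrite /eta ge_min lexx.
    rewrite -(ler_pM2l K0) => /le_trans; apply.
    by rewrite invfM mulrCA divff ?gt_eqF// mulr1.
  have := TK (y - E); lra.
apply: le_trans Hu _.
have H3 : eta <= e / (2 * K ^+ 2) by rewrite /eta ge_min lexx orbT.
apply: (@le_trans _ _ (K * (e / (2 * K ^+ 2) * (2 * K * `|y - E|)))).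
  rewrite ler_pM2l//; apply: ler_pM => //; exact: ltW.
rewrite le_eqVlt; apply/orP; left; apply/eqP; field.
by rewrite gt_eqF.
Qed.

(** Bootstrapping: the derivative of [g] has entries built from [invmx (J b)] evaluated at
    [b = g E]. If [g] is of class C^k so are they, and [g] is of class C^(k+1); continuity starts
    the induction. *)
Lemma smooth_inverse : smooth_on U' g.
Proof.
have invC k i j : of_class_C k [set: 'rV[R]_n] (fun b => invmx (J b) i j : R^o).
  apply: of_class_C_invmx => //; first exact: openT.
  move=> i' j'; have [_ /(_ (delta_mx 0 i'))] := fsmooth k.+1.
  move=> /(of_class_C_mx_entry j' 0 openT).
  by under [X in _ -> of_class_C _ _ X]eq_fun do rewrite mxE.
elim=> [|k IH] //; split=> [E UE|v].
  by have ? := diffg UE; exact: ex_diff.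
have Cs : of_class_C k U' (fun E =>
    \sum_j (\sum_l (v^T 0 l * ((fun b => invmx (J b) l j : R^o) \o g) E) : R^o)
      *: (delta_mx 0 j : 'rV[R]_n)).
  apply: of_class_C_sum => // j _; apply: of_class_C_scale => //.
  apply: of_class_C_sum => // l _; apply: of_class_C_mul => //.
    exact: of_class_C_cst.
  by apply: (of_class_C_comp (U' := setT)) => //; exact: openT.
apply: (of_class_C_congr oU') Cs => E UE.
have H := diffg UE.
rewrite deriveE; last exact: ex_diff.
rewrite diff_val /T [RHS]row_sum_delta.
by apply: eq_bigr => j _; rewrite mxE.
Qed.

End SmoothInverse.

(** * Pairings and polytopes *)

Section Pairing.
Context {R : realType} {n : nat}.
Implicit Types (b c : 'rV[R]_n) (x y : 'cV[R]_n).

Lemma pairing_sum b x : pairing b x = \sum_i b 0 i * x i 0.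
Proof. by rewrite /pairing mxE. Qed.

Lemma pairing_linear b : linear (pairing b : _ -> R^o).
Proof. by move=> a x y; rewrite /pairing linearP/= !mxE. Qed.

Lemma pairingDr b x y : pairing b (x + y) = pairing b x + pairing b y.
Proof. by rewrite /pairing mulmxDr mxE. Qed.

Lemma pairingBr b x y : pairing b (x - y) = pairing b x - pairing b y.
Proof. by rewrite /pairing mulmxBr !mxE. Qed.

Lemma pairingNr b x : pairing b (- x) = - pairing b x.
Proof. by rewrite /pairing mulmxN mxE. Qed.

Lemma pairingZr b a x : pairing b (a *: x) = a * pairing b x.
Proof. by rewrite /pairing -scalemxAr mxE. Qed.

Lemma pairing_sumr b (I : Type) (r : seq I) (F : I -> 'cV[R]_n) :
  pairing b (\sum_(i <- r) F i) = \sum_(i <- r) pairing b (F i).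
Proof. by rewrite /pairing mulmx_sumr summxE. Qed.

Lemma pairing_linearl x : linear ((fun b => pairing b x) : _ -> R^o).
Proof. by move=> a b c; rewrite /pairing mulmxDl -scalemxAl !mxE. Qed.

Lemma pairingDl b c x : pairing (b + c) x = pairing b x + pairing c x.
Proof. by rewrite /pairing mulmxDl mxE. Qed.

Lemma pairingBl b c x : pairing (b - c) x = pairing b x - pairing c x.
Proof. by rewrite /pairing mulmxBl !mxE. Qed.

Lemma pairingZl a b x : pairing (a *: b) x = a * pairing b x.
Proof. by rewrite /pairing -scalemxAl mxE. Qed.

Lemma pairing0l x : pairing 0 x = 0.
Proof. by rewrite /pairing mul0mx mxE. Qed.

Lemma pairing0r b : pairing b 0 = 0.
Proof. by rewrite /pairing mulmx0 mxE. Qed.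

Lemma mx_entry_norm p q (M : 'M[R]_(p, q)) i j : `|M i j| <= `|M|.
Proof.
by rewrite [leRHS]/Num.norm/= mx_normrE; apply: (le_bigmax _ _ (i, j)).
Qed.

Lemma mx_norm_le p q (M : 'M[R]_(p, q)) r :
  0 <= r -> (forall i j, `|M i j| <= r) -> `|M| <= r.
Proof.
by move=> r0 H; rewrite [leLHS]/Num.norm/= mx_normrE; apply: bigmax_le.
Qed.

Lemma norm_pairing b x : `|pairing b x| <= n%:R * `|b| * `|x|.
Proof.
rewrite pairing_sum; apply: le_trans (ler_norm_sum _ _ _) _.
have -> : n%:R * `|b| * `|x| = \sum_(i < n) `|b| * `|x|.
  by rewrite sumr_const card_ord -mulrA mulr_natl.
by apply: ler_sum => i _; rewrite normrM ler_pM// mx_entry_norm.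
Qed.

End Pairing.

(** * Convexity and concavity with explicit real coefficients *)

Section ConvexSets.
Context {R : realType} (M : lmodType R).
Implicit Types (x y : M) (t : R).

Lemma convex_setP (K : set M) :
  @convex_set R M K <->
  forall x y t, K x -> K y -> 0 <= t -> t <= 1 -> K (t *: x + (1 - t) *: y).
Proof.
split=> [cK x y t Kx Ky t0 t1|cK x y l Kx Ky].
  by have := cK x y (Itv01 t0 t1) (mem_set Kx) (mem_set Ky); rewrite inE.
by rewrite inE; apply: cK; [exact: set_mem|exact: set_mem|exact: ge0|exact: le1].
Qed.

Lemma concave_onP (U : set M) (f : M -> R) :
  @convex_set R M U ->
  (forall x y t, U x -> U y -> 0 <= t -> t <= 1 ->
    t * f x + (1 - t) * f y <= f (t *: x + (1 - t) *: y)) ->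
  concave_on U f.
Proof.
move=> cU H; split=> // l x y /set_mem Ux /set_mem Uy.
apply: (@le_trans _ _ (- (l%:num * f x + (1 - l%:num) * f y))).
  by rewrite lerN2; exact: H (ge0 l) (le1 l).
by rewrite opprD -!mulrN.
Qed.

End ConvexSets.

(** * Convex combinations and interior points of a polytope *)

Section Polytope.
Context {R : realType} {n : nat} (A : {fset 'cV[R]_n}).
Implicit Types (b c : 'rV[R]_n) (x y E : 'cV[R]_n) (t : R).
Local Notation Q := (polytope A).

Lemma polytope_vertex (w : A) : Q (val w).
Proof. by apply: sub_smallest; [exact: subset_refl|exact: valP]. Qed.

Lemma polytope_convex x y t :
  Q x -> Q y -> 0 <= t -> t <= 1 -> Q (t *: x + (1 - t) *: y).
Proof.
move=> Qx Qy t0 t1 K [cK AK].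
move/convex_setP : (cK); apply=> //; [exact: Qx|exact: Qy].
Qed.

Lemma polytope_min (K : set 'cV[R]_n) : @convex_set R _ K ->
  (forall w : A, K (val w)) -> Q `<=` K.
Proof.
move=> cK AK; apply: smallest_sub => // x /= xA.
exact: (AK [` xA]%fset).
Qed.

Lemma polytope_nonempty x : Q x -> exists w : A, True.
Proof.
move=> Qx; apply: contrapT => noA.
suff : (set0 : set 'cV[R]_n) x by [].
apply: polytope_min Qx => [|w]; first by apply/convex_setP.
by case: noA; exists w.
Qed.

Lemma polytope_combination x :
  Q x -> exists2 p, simplex p & x = \sum_(w : A) p w *: val w.
Proof.
pose K := [set x | exists2 p, simplex p & x = \sum_(w : A) p w *: val w].
suff : Q `<=` K by move=> /[apply].
apply: polytope_min.
  apply/convex_setP => _ _ t [p [p0 p1] ->] [q [q0 q1] ->] t0 t1.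
  exists (fun w => t * p w + (1 - t) * q w).
    split=> [w|]; first by rewrite addr_ge0 ?mulr_ge0 ?subr_ge0.
    by rewrite big_split/= -!mulr_sumr p1 q1 !mulr1 subrKC.
  rewrite !scaler_sumr -big_split; apply: eq_bigr => w _ /=.
  by rewrite !scalerA -scalerDl.
move=> w; exists (fun v => (v == w)%:R).
  split=> [v|]; first exact: ler0n.
  by rewrite (bigD1 w)//= eqxx big1 ?addr0// => v /negbTE ->.
by rewrite (bigD1 w)//= eqxx scale1r big1 ?addr0// => v /negbTE ->; rewrite scale0r.
Qed.

(** Partial sums do not have total weight 1, so the induction carries the homogeneous form: a
    partial sum is its total weight times some point of [Q]. When that weight is 0 any point will
    do, for instance [val w0] for the empty sum. *)
Lemma polytope_sum (p : A -> R) : simplex p -> Q (\sum_w p w *: val w).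
Proof.
move=> [p0 p1].
have [w0 _] : exists w : A, True.
  apply: contrapT => noA; move: p1; rewrite big1; first by move/eqP; rewrite eq_sym oner_eq0.
  by move=> w; case: noA; exists w.
have H (r : seq A) : exists2 x, Q x &
    \sum_(w <- r) p w *: val w = (\sum_(w <- r) p w) *: x.
  elim: r => [|a r [x Qx IH]].
    by exists (val w0); [exact: polytope_vertex|rewrite !big_nil scale0r].
  have S0 : 0 <= \sum_(w <- r) p w by rewrite sumr_ge0.
  rewrite !big_cons IH; set S := \sum_(w <- r) p w in S0 *.
  have [s0|s0] := eqVneq (p a + S) 0.
    move/eqP: s0; rewrite paddr_eq0// => /andP[/eqP-> /eqP->].
    by exists x => //; rewrite addr0 !scale0r addr0.
  have sp : 0 < p a + S by rewrite lt_def s0 addr_ge0.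
  exists ((p a / (p a + S)) *: val a + (1 - p a / (p a + S)) *: x).
    apply: polytope_convex => //; first exact: polytope_vertex.
      by rewrite divr_ge0// ltW.
    by rewrite ler_pdivrMr// mul1r lerDl.
  rewrite scalerDr !scalerA mulrBr mulrCA divff// !mulr1.
  by rewrite [p a + S in RHS]addrC addrK.
by have [x Qx ->] := H (index_enum A); rewrite p1 scale1r.
Qed.

Lemma interior_ballP (K : set 'cV[R]_n) E :
  interior K E <-> exists2 t, 0 < t & forall v, `|v| <= t -> K (E + v).
Proof.
split=> [/nbhs_normP[r /= r0 H]|[t t0 H]].
  exists (r / 2); first by rewrite divr_gt0.
  move=> v vr; apply: H; rewrite /ball_/= opprD addrA subrr sub0r normrN.
  by rewrite (le_lt_trans vr)// ltr_pdivrMr// ltr_pMr// ltr1n.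
suff : \near E, K E by [].
apply/nbhs_normP; exists t => //= x; rewrite /ball_/= distrC => /ltW/H.
by rewrite subrKC.
Qed.

(** A displacement [v] of the combination is obtained by displacing both end points by the same [v],
    so the smaller of the two radii works. *)
Lemma interior_convex : @convex_set R _ (interior Q).
Proof.
apply/convex_setP => x y t /interior_ballP[r r0 Hx] /interior_ballP[s s0 Hy] t0 t1.
apply/interior_ballP; exists (Num.min r s); first by rewrite lt_min r0.
move=> v; rewrite le_min => /andP[vr vs].
rewrite (_ : _ + v = t *: (x + v) + (1 - t) *: (y + v)).
  by apply: polytope_convex => //; [exact: Hx|exact: Hy].
by rewrite !scalerDr addrACA -scalerDl subrKC scale1r.
Qed.

(* The half-space of all x with - (b, x - E) < t |b| contains no E + v with
   v = - t sgn(b_j) e_j, where j realizes the sup norm of b. *)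
Lemma polytope_support E t : 0 <= t ->
  (forall v, `|v| <= t -> Q (E + v)) ->
  forall b, exists w : A, t * `|b| <= - pairing b (val w - E).
Proof.
move=> t0 HE b; apply: contrapT => /forallNP H.
pose K := [set x | - pairing b (x - E) < t * `|b|].
have QK : Q `<=` K.
  apply: polytope_min => [|w]; last by rewrite /K/= ltNge; apply/negP/H.
  apply/convex_setP => x y s; rewrite /K/= !pairingBr pairingDr !pairingZr.
  set u := pairing b x; set v := pairing b y; set e := pairing b E.
  set m := t * `|b| => Hx Hy s0 s1.
  (* Strictness has to come from an end point of nonzero weight: from [y] when [s = 0], from [x]
     otherwise. *)
  have [->|sN0] := eqVneq s 0; first by lra.
  have sp : 0 < s by rewrite lt_def sN0.
  by nra.
have [b0|b0] := eqVneq b 0.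
  have /QK : Q (E + 0) by apply: HE; rewrite normr0.
  by rewrite /K/= b0 pairing0l normr0 mulr0 oppr0 ltxx.
have [[i j] /= bij] : exists ij, `|b| = `|b ij.1 ij.2|.
  by apply: mx_norm_neq0; rewrite -[mx_norm b]/(`|b|) normr_eq0.
pose v : 'cV[R]_n := (- (t * Num.sg (b 0 j))) *: delta_mx j 0.
have sg1 : `|Num.sg (b 0 j)| <= 1 by rewrite normr_sg lern1 leq_b1.
have /HE/QK : `|v| <= t.
  apply: mx_norm_le => // k l; rewrite !mxE normrM normrN normrM (ger0_norm t0).
  rewrite -mulrA ler_piMr// mulr_ile1//.
  by case: (_ && _); rewrite ?normr1 ?normr0.
rewrite /K/= addrC addKr pairingZr mulNr opprK.
have -> : pairing b (delta_mx j 0) = b 0 j.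
  by rewrite /pairing -colE mxE.
by rewrite -mulrA -normrEsg bij ord1 ltxx.
Qed.

(** One radius [t] serves all linear forms [b] at once. This uniformity gives coercivity later on,
    while the case of a single nonzero [b] gives strictness and definiteness. *)
Lemma interior_support E : interior Q E ->
  exists2 t, 0 < t & forall b, exists w : A, t * `|b| <= - pairing b (val w - E).
Proof.
move=> /interior_ballP[t t0 H]; exists t => //.
by apply: polytope_support => //; exact: ltW.
Qed.

Lemma interior_separates E b : interior Q E ->
  (forall w : A, pairing b (val w - E) = 0) -> b = 0.
Proof.
move=> /interior_support[t t0 /(_ b)[w +]] H; rewrite H oppr0.
by rewrite pmulr_rle0// normr_le0 => /eqP.
Qed.

End Polytope.

(** * Gibbs distributions *)

Section GibbsDistribution.
Context {R : realType} {n : nat} (A : {fset 'cV[R]_n}).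
Hypothesis intQ : interior (polytope A) !=set0.
Implicit Types (b c v : 'rV[R]_n) (E : 'cV[R]_n).
Local Notation Q := (polytope A).
Local Notation Z := (partition_fun A).
Local Notation F := (fun b => ln (partition_fun A b)).
Local Notation mean := (mean_energy A).

Lemma vertex_ex : exists w : A, True.
Proof. by have [E /interior_subset] := intQ; exact: polytope_nonempty. Qed.

Lemma partition_fun_gt0 b : 0 < Z b.
Proof.
have [w _] := vertex_ex; rewrite /partition_fun (bigD1 w)//=.
by rewrite ltr_pwDl ?expR_gt0// sumr_ge0// => i _; exact: expR_ge0.
Qed.

Lemma ln_partition_fun_ge b (w : A) : - pairing b (val w) <= F b.
Proof.
rewrite -ler_expR lnK ?posrE ?partition_fun_gt0// /partition_fun (bigD1 w)//=.
by rewrite lerDl sumr_ge0// => i _; exact: expR_ge0.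
Qed.

Lemma gibbs_gt0 b w : 0 < gibbs A b w.
Proof. by rewrite divr_gt0 ?expR_gt0 ?partition_fun_gt0. Qed.

Lemma gibbs_simplex b : simplex (gibbs A b).
Proof.
split=> [w|]; first exact/ltW/gibbs_gt0.
by rewrite -mulr_suml divff// gt_eqF// partition_fun_gt0.
Qed.

Lemma mean_energyE b : mean b = \sum_(w : A) gibbs A b w *: val w.
Proof.
by rewrite /mean_energy scaler_sumr; apply: eq_bigr => w _; rewrite scalerA mulrC.
Qed.

Lemma gibbs_constrained b : constrained (mean b) (gibbs A b).
Proof. by split; [exact: gibbs_simplex|rewrite mean_energyE]. Qed.

(** Cancels the first-order term in the Jensen estimate and the cross term when the covariance form
    is written as a sum of squares. *)
Lemma gibbs_centered b c : \sum_(w : A) gibbs A b w * pairing c (val w - mean b) = 0.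
Proof.
have [_ p1] := gibbs_simplex b.
under eq_bigr do rewrite pairingBr mulrBr.
rewrite sumrB -mulr_suml p1 mul1r mean_energyE pairing_sumr.
by rewrite (eq_bigr _ (fun w _ => pairingZr c _ _)) subrr.
Qed.

(* Writing the mean as eps x0 + (1 - eps) y with x0 interior and y in Q, for eps
   below all Gibbs weights: the homothety of ratio eps centered at y maps a
   neighbourhood of x0 into Q. *)
Lemma mean_energy_interior b : interior Q (mean b).
Proof.
have [x0 intx0] := intQ; have [q [q0 q1] x0E] := polytope_combination (interior_subset intx0).
have [r r0 Hr] := (interior_ballP _ _).1 intx0.
have [p0 p1] := gibbs_simplex b.
(* The default value 1 of the minimum, together with the halving, also ensures [e < 1], so that one
   can divide by [1 - e]. *)
pose e := (\big[Num.min/1]_(w : A) gibbs A b w) / 2.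
have m0 : 0 < \big[Num.min/1]_(w : A) gibbs A b w.
  by apply/bigmin_gtP; split=> // w _; exact: gibbs_gt0.
have e0 : 0 < e by rewrite divr_gt0.
have m1 : \big[Num.min/1]_(w : A) gibbs A b w <= 1 by exact: bigmin_le_id.
have e1 : e < 1 by rewrite /e; lra.
have ep w : e <= gibbs A b w.
  have : \big[Num.min/1]_(w : A) gibbs A b w <= gibbs A b w by exact: bigmin_le.
  rewrite /e; lra.
have q1w w : q w <= 1.
  by rewrite -q1 (bigD1 w)//= lerDl sumr_ge0.
have e1' : 0 < 1 - e by rewrite subr_gt0.
pose y := \sum_(w : A) ((gibbs A b w - e * q w) / (1 - e)) *: val w.
have Qy : Q y.
  apply: polytope_sum; split=> [w|].
    apply: divr_ge0; last exact: ltW.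
    rewrite subr_ge0 (le_trans _ (ep w))//.
    by rewrite ler_piMr// ltW.
  by rewrite -mulr_suml sumrB -mulr_sumr p1 q1 mulr1 divff// gt_eqF.
have mE : mean b = e *: x0 + (1 - e) *: y.
  rewrite mean_energyE x0E /y !scaler_sumr -big_split; apply: eq_bigr => w _ /=.
  by rewrite !scalerA -scalerDl mulrCA divff ?gt_eqF// mulr1 addrC subrK.
apply/interior_ballP; exists (e * r); first by rewrite mulr_gt0.
move=> v vr.
have -> : mean b + v = e *: (x0 + e^-1 *: v) + (1 - e) *: y.
  by rewrite mE scalerDr scalerA divff ?gt_eqF// scale1r addrAC.
apply: polytope_convex => //; [apply: Hr|exact: ltW|exact: ltW].
by rewrite normrZ normfV (gtr0_norm e0) ler_pdivrMl.
Qed.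

(* By convexity of exp, applied to
   Z(c) / Z(b) = sum_w p_w(b) exp(- (c - b, w)). *)
Lemma gibbs_ineq_lt b c : c != b ->
  pairing b (mean b) + F b < pairing c (mean b) + F c.
Proof.
move=> cb; have [p0 p1] := gibbs_simplex b.
pose x (w : A) := - pairing (c - b) (val w - mean b).
have ratio : \sum_(w : A) gibbs A b w * expR (x w) =
    expR (pairing (c - b) (mean b)) * Z c / Z b.
  rewrite /partition_fun mulr_sumr mulr_suml; apply: eq_bigr => w _.
  rewrite -expRD mulrAC -expRD /x; congr (expR _ / _).
  by rewrite pairingBr !pairingBl; lra.
have : 1 < expR (pairing (c - b) (mean b)) * Z c / Z b.
  have [t t0 /(_ (c - b))[w0 Hw0]] := interior_support (mean_energy_interior b).
  have x0 : 0 < x w0 by apply: lt_le_trans Hw0; rewrite mulr_gt0// normr_gt0 subr_eq0.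
  (* Jensen in tangent form: [x] has mean zero, and [1 + x w <= expR (x w)] holds termwise, strictly
     at [w0] because [x w0] is nonzero. *)
  have -> : 1 = \sum_(w : A) gibbs A b w * (1 + x w).
    under eq_bigr do rewrite mulrDr mulr1 mulrN.
    by rewrite big_split/= p1 sumrN gibbs_centered subr0.
  rewrite -ratio [ltLHS](bigD1 w0)//= [ltRHS](bigD1 w0)//=.
  apply: ltr_leD.
    by rewrite ltr_pM2l ?gibbs_gt0// expR_gt1Dx// gt_eqF.
  by apply: ler_sum => w _; rewrite ler_pM2l ?gibbs_gt0// expR_ge1Dx.
have [Zb Zc] := (partition_fun_gt0 b, partition_fun_gt0 c).
rewrite ltr_pdivlMr// mul1r -ltr_ln ?posrE ?mulr_gt0 ?expR_gt0//.
by rewrite lnM ?posrE ?expR_gt0// expRK pairingBl; lra.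
Qed.

Lemma gibbs_ineq b c : pairing b (mean b) + F b <= pairing c (mean b) + F c.
Proof. by have [->//|/gibbs_ineq_lt/ltW] := eqVneq c b. Qed.

Lemma mean_energy_inj : injective mean.
Proof.
move=> b c bc; apply/eqP/negP => /negP cb.
have := gibbs_ineq_lt cb; rewrite eq_sym in cb.
by have := gibbs_ineq_lt cb; rewrite bc; lra.
Qed.

(** * Smoothness and differential of the mean energy *)

Lemma of_class_C_weight k (w : 'cV[R]_n) :
  of_class_C k [set: 'rV[R]_n] (fun b => expR (- pairing b w) : R^o).
Proof.
apply: of_class_C_expR; first exact: openT.
apply: of_class_C_linear; first exact: openT.
by move=> a x y; rewrite pairing_linearl opprD scalerN.
Qed.

Lemma of_class_C_partition_fun k : of_class_C k [set: 'rV[R]_n] (Z : _ -> R^o).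
Proof.
by apply: of_class_C_sum => [|w _]; [exact: openT|exact: of_class_C_weight].
Qed.

Lemma of_class_C_gibbs k (w : A) :
  of_class_C k [set: 'rV[R]_n] (fun b => gibbs A b w : R^o).
Proof.
apply: of_class_C_mul; [exact: openT|exact: of_class_C_weight|].
apply: of_class_C_inv; [exact: openT| |exact: of_class_C_partition_fun].
by move=> b _; rewrite gt_eqF// partition_fun_gt0.
Qed.

Lemma mean_energy_smooth : smooth_on [set: 'rV[R]_n] mean.
Proof.
move=> k; have oT := @openT 'rV[R]_n.
apply: (of_class_C_congr oT (f := fun b => \sum_(w : A) gibbs A b w *: val w)).
  by move=> b _; rewrite mean_energyE.
apply: (of_class_C_sum oT) => w _; apply: (of_class_C_scale oT).
exact: of_class_C_gibbs.
Qed.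

Lemma mean_energy_continuous : continuous mean.
Proof. by move=> b; exact: (mean_energy_smooth 0). Qed.

Lemma derive_gibbs v b (w : A) :
  'D_v (fun c => gibbs A c w : R^o) b = gibbs A b w * pairing v (mean b - val w).
Proof.
have dw (x : 'cV[R]_n) : differentiable (fun c => expR (- pairing c x) : R^o) b /\
    'D_v (fun c => expR (- pairing c x) : R^o) b
      = expR (- pairing b x) * - pairing v x.
  have linx : linear ((fun c => - pairing c x) : _ -> R^o).
    by move=> a y z; rewrite pairing_linearl opprD scalerN.
  have [dl Dl] := derive_linear b v linx.
  by have [de ->] := derive_expR_comp v dl; rewrite Dl.
have [dZ DZ] := @derive_bigsum _ _ _ _ _ (index_enum A)
  (fun w c => expR (- pairing c (val w)) : R^o) b v (fun w => (dw (val w)).1).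
have [dg _] := of_class_C_gibbs 1 w.
have Zb := gt_eqF (partition_fun_gt0 b).
(* Instead of differentiating a quotient, the product of the Gibbs weight and [Z], which is the
   plain exponential, is differentiated and the equation is solved for the derivative of the
   weight. *)
have : 'D_v (fun c => gibbs A c w * Z c : R^o) b =
    expR (- pairing b (val w)) * - pairing v (val w).
  rewrite -(dw (val w)).2; congr ('D_v _ b); apply/funext => c.
  by rewrite /gibbs mulfVK// gt_eqF// partition_fun_gt0.
rewrite deriveM; [|exact/diff_derivable/dg|exact: diff_derivable].
rewrite DZ (eq_bigr _ (fun w _ => (dw (val w)).2)).
have -> : \sum_(w : A) expR (- pairing b (val w)) * - pairing v (val w) =
    - (Z b * pairing v (mean b)).
  rewrite mean_energyE pairing_sumr mulr_sumr -sumrN; apply: eq_bigr => w' _.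
  rewrite pairingZr mulrA [Z b * _]mulrC /gibbs mulfVK ?Zb//. by rewrite mulrN.
rewrite /GRing.scale/= => H.
apply: (mulfI (negbT Zb)); rewrite -[LHS](addKr (gibbs A b w * - (Z b * pairing v (mean b)))).
rewrite H pairingBr /gibbs; field.
exact: negbT Zb.
Qed.

(* The differential of the mean energy is minus the covariance form, which is
   definite because A affinely spans the whole space. *)
Lemma derive_mean_energy_inj b v : 'D_v mean b = 0 -> v = 0.
Proof.
have dg w := (of_class_C_gibbs 1 w).1 b I.
have [_ Dm] := @derive_bigsum _ _ _ _ _ (index_enum A)
  (fun w c => gibbs A c w *: val w) b v (fun w => (derive_scale (val w) v (dg w)).1).
have -> : 'D_v mean b = \sum_(w : A) (gibbs A b w * pairing v (mean b - val w)) *: val w.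
  rewrite (_ : mean = fun c => \sum_(w : A) gibbs A c w *: val w); last first.
    by apply/funext => c; rewrite mean_energyE.
  rewrite Dm; apply: eq_bigr => w _.
  by rewrite (derive_scale (val w) v (dg w)).2 derive_gibbs -mean_energyE.
move/(congr1 (pairing v)).
rewrite pairing_sumr pairing0r => H.
(* The variance of [v] is minus the pairing of [v] with the derivative of the mean, up to the terms
   [r w], whose sum vanishes by [gibbs_centered]. *)
have : \sum_(w : A) gibbs A b w * pairing v (val w - mean b) ^+ 2 = 0.
  pose q (w : A) := pairing v ((gibbs A b w * pairing v (mean b - val w)) *: val w).
  pose r (w : A) := gibbs A b w * pairing (pairing v (mean b) *: v) (val w - mean b).
  transitivity (\sum_(w : A) (- q w - r w)).
    apply: eq_bigr => w _.
    by rewrite /q /r pairingZr pairingZl !pairingBr; ring.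
  by rewrite sumrB sumrN H gibbs_centered subr0 oppr0.
move/eqP; rewrite psumr_eq0 => [/allP H0|w _]; last first.
  by rewrite mulr_ge0 ?sqr_ge0// ltW// gibbs_gt0.
apply: (interior_separates (mean_energy_interior b)) => w.
have := H0 w (mem_index_enum w); rewrite /= mulf_eq0 gt_eqF ?gibbs_gt0//=.
by rewrite sqrf_eq0 => /eqP.
Qed.

(** By [gibbs_ineq] in both orders, the remainder at [c] lies between 0 and
    [- pairing (c - b) (mean c - mean b)], which is the situation of [is_diff_sandwich]. *)
Lemma ln_partition_fun_gradient b : has_dual_gradient F b (- mean b).
Proof.
apply: (@is_diff_sandwich _ _ _ _ _ _ mean n%:R).
- exact: pairing_linearl.
- exact: mean_energy_continuous.
near=> c.
have := norm_pairing (c - b) (mean c - mean b).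
have := gibbs_ineq b c; have := gibbs_ineq c b.
rewrite pairingNr pairingBr !pairingBl -[n%:R * _ * _]mulrAC.
set N := n%:R * _ * _; rewrite !ler_norml; lra.
Unshelve. all: by end_near. Qed.

Lemma mean_energy_surj E : interior Q E -> exists b, mean b = E.
Proof.
move=> intE; have [t t0 Ht] := interior_support intE.
pose g b := pairing b E + F b.
have gcoer b : t * `|b| <= g b.
  have [w Hw] := Ht b; apply: le_trans Hw _; rewrite /g pairingBr.
  by have := ln_partition_fun_ge b w; lra.
have gdiff b : is_diff b (g : _ -> R^o) (fun v => pairing v (E - mean b)).
  have H := ln_partition_fun_gradient b.
  apply/is_diff_epsP; first exact: pairing_linearl.
  move=> e e0; have := (is_diff_epsP _ _ (pairing_linearl _)).1 H _ e0.
  apply: filterS => c; congr (`|_| <= _).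
  by rewrite /g !pairingBr pairingNr !pairingBl; lra.
have gcont : continuous (g : _ -> R^o).
  by move=> b; apply: differentiable_continuous; have ? := gdiff b; exact: ex_diff.
(* Outside this ball coercivity forces [g] above [g 0], so the minimum over the ball is a global
   one. *)
pose K := [set b | `|b| <= g 0 / t] : set 'rV[R]_n.
have g00 : 0 <= g 0 by have := gcoer 0; rewrite normr0 mulr0.
have K0 : K 0 by rewrite /K/= normr0 divr_ge0// ltW.
have cK : compact K by exact: compact_norm_le.
have [b0 _ Hb0] : exists2 b, b \in K & forall c, c \in K -> g b <= g c.
  apply: EVT_min_rV => //; first by exists 0.
  exact: continuous_subspaceT.
have gmin c : g b0 <= g c.
  have [cK'|] := boolP (c \in K); first exact: Hb0.
  rewrite notin_setE /K/= => /negP; rewrite -ltNge ltr_pdivrMr// mulrC => gc.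
  by apply: le_trans (Hb0 0 (mem_set K0)) _; apply: le_trans (ltW gc) (gcoer c).
exists b0; apply/eqP; rewrite eq_sym -subr_eq0; apply/eqP.
(* At the minimum the differential [pairing v (E - mean b0)] vanishes for every [v]; the basis
   vectors then give [E = mean b0]. *)
have dg0 := is_diff_min (gdiff b0) (pairing_linearl _) gmin.
apply/matrixP => i j; have := dg0 (delta_mx 0 i).
by rewrite ord1 /pairing -rowE mxE => ->; rewrite mxE.
Qed.

(** * The inverse map and its continuity *)

Lemma mean_energy_beta E : interior Q E -> mean (beta_of A E) = E.
Proof. by move=> /mean_energy_surj; exact: getPex. Qed.

Lemma beta_mean_energy b : beta_of A (mean b) = b.
Proof. by apply: mean_energy_inj; apply: mean_energy_beta; exact: mean_energy_interior. Qed.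

(* Near E the coercivity estimate confines beta_of to a fixed ball, on which the
   continuous injection mean is closed. *)
Lemma beta_of_continuous E : interior Q E -> {for E, continuous (beta_of A)}.
Proof.
move=> intE; have [t t0 Ht] := (interior_ballP _ _).1 intE.
(* Every point within [t / 2] of [E] is still the center of a ball of radius [t / 2] inside [Q],
   which makes the bound on [beta_of] uniform. *)
have t20 : 0 < t / 2 by rewrite divr_gt0.
have betab E' : `|E' - E| <= t / 2 -> `|beta_of A E'| <= F 0 / (t / 2).
  move=> EE'; have HE' (v : 'cV[R]_n) : `|v| <= t / 2 -> Q (E' + v).
    move=> vt; rewrite -[E' + v](subrKC E); apply: Ht.
    by rewrite addrAC (le_trans (ler_normD _ _))//; lra.
  have intE' : interior Q E' by apply/interior_ballP; exists (t / 2).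
  set b := beta_of A E'.
  have [w Hw] := polytope_support (ltW t20) HE' b.
  rewrite ler_pdivlMr// mulrC (le_trans Hw)//.
  have := gibbs_ineq b 0; rewrite mean_energy_beta// pairing0l add0r.
  apply: le_trans; rewrite pairingBr.
  by have := ln_partition_fun_ge b w; lra.
apply: continuous_dist_lt => e e0; set b0 := beta_of A E.
(* The bounded parameters at distance at least [e] from [b0]. By injectivity their image misses [E],
   and being compact it misses a neighbourhood of [E]. *)
pose K := [set b | `|b| <= F 0 / (t / 2)] `&` ~` ball b0 e.
have cK : compact K.
  apply: compact_closedI; first exact: compact_norm_le.
  by apply: open_closedC; exact: ball_open.
have clK : closed (mean @` K).
  apply: compact_closed; first exact: norm_hausdorff.
  apply: continuous_compact => //; apply: continuous_subspaceT.
  exact: mean_energy_continuous.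
have nE : \forall E' \near E, (~` (mean @` K)) E'.
  apply: open_nbhs_nbhs; split; first exact: closed_openC.
  move=> [b [_ bK] bE]; apply: bK; rewrite /b0 -bE beta_mean_energy.
  exact: ballxx.
have dE : \forall E' \near E, `|E' - E| <= t / 2.
  apply/nbhs_normP; exists (t / 2) => //= E'; rewrite /ball_/= distrC; exact: ltW.
have iE : \forall E' \near E, interior Q E'.
  by apply: open_nbhs_nbhs; split=> //; exact: open_interior.
near=> E'.
have : (~` (mean @` K)) E' by near: E'.
apply: contra_notT => H; exists (beta_of A E'); last first.
  by apply: mean_energy_beta; near: E'.
split; first by apply: betab; near: E'.
by move: H; rewrite -ball_normE => /negP.
Unshelve. all: by end_near. Qed.

(** * Entropy: value, maximality and gradient *)

Lemma entropy_gibbs b : entropy (gibbs A b) = pairing b (mean b) + F b.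
Proof.
have [_ p1] := gibbs_simplex b.
rewrite /entropy (eq_bigr (fun w => - (gibbs A b w * pairing b (val w))
    - gibbs A b w * F b)).
  rewrite sumrB sumrN -mulr_suml p1 mul1r opprB opprK addrC mean_energyE pairing_sumr.
  by congr (_ + _); apply: eq_bigr => w _; rewrite pairingZr.
move=> w _; rewrite {2}/gibbs ln_div ?posrE ?expR_gt0 ?partition_fun_gt0//.
by rewrite expRK mulrBr mulrN.
Qed.

Lemma entropy_atE E : interior Q E ->
  entropy_at A E = pairing (beta_of A E) E + F (beta_of A E).
Proof. by move=> intE; rewrite /entropy_at entropy_gibbs mean_energy_beta. Qed.

(** The dual reading of [gibbs_ineq]: for fixed [c] the right-hand side is affine in [E], so the
    entropy lies below a family of affine functions, touching that of [c = beta_of A E] at [E]. *)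
Lemma entropy_at_le E c : interior Q E -> entropy_at A E <= pairing c E + F c.
Proof.
move=> intE; rewrite entropy_atE//.
by have := gibbs_ineq (beta_of A E) c; rewrite mean_energy_beta.
Qed.

(** The logarithm of a Gibbs weight is affine in [w], so its average is the same for all [p] under
    the constraint. The claim becomes nonnegativity of the relative entropy of [p] with respect to
    the Gibbs distribution. *)
Lemma entropy_le (p : A -> R) b :
  constrained (mean b) p -> entropy p <= entropy (gibbs A b).
Proof.
move=> [[p0 p1] pE]; rewrite entropy_gibbs.
have -> : pairing b (mean b) + F b = - \sum_(w : A) p w * ln (gibbs A b w).
  rewrite -pE pairing_sumr -[F b]mul1r -p1 mulr_suml -big_split -sumrN.
  apply: eq_bigr => w _ /=; rewrite {1}/gibbs.
  rewrite ln_div ?posrE ?expR_gt0 ?partition_fun_gt0//.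
  by rewrite expRK pairingZr; lra.
rewrite /entropy lerN2 -subr_ge0 -sumrB.
have [_ g1] := gibbs_simplex b.
(* The lower bound 0 is written as a difference of total masses to allow a termwise comparison
   through [ln x <= x - 1] at [x = gibbs A b w / p w]; the terms with [p w = 0] are treated
   apart. *)
apply: (@le_trans _ _ (\sum_(w : A) (p w - gibbs A b w))).
  by rewrite sumrB p1 g1 subrr.
apply: ler_sum => w _; have gw := gibbs_gt0 b w.
have [->|pw0] := eqVneq (p w) 0; first by rewrite !mul0r subrr sub0r oppr_le0 ltW.
have pw : 0 < p w by rewrite lt_def pw0 p0.
rewrite -mulrBr -ln_div ?posrE// -[leLHS]opprB -[leRHS]opprK lerN2 -mulrN.
rewrite -lnV; last by rewrite posrE divr_gt0.
rewrite invf_div.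
have : ln (1 + (gibbs A b w / p w - 1)) <= gibbs A b w / p w - 1.
  by apply: le_ln1Dx; have := divr_gt0 gw pw; lra.
rewrite subrKC => H; apply: (@le_trans _ _ (p w * (gibbs A b w / p w - 1))).
  by rewrite ler_pM2l.
by rewrite mulrBr mulrCA divff// !mulr1.
Qed.

(** Same sandwich as for [ln Z] with the two spaces exchanged: the affine bounds taken at
    [beta_of A E] and at [beta_of A E'] enclose the increment, and [beta_of] is continuous at
    [E]. *)
Lemma entropy_at_gradient E : interior Q E -> has_gradient (entropy_at A) E (beta_of A E).
Proof.
move=> intE; apply: (@is_diff_sandwich _ _ _ _ _ _ (beta_of A) n%:R).
- exact: pairing_linear.
- exact: beta_of_continuous.
have iE : \forall E' \near E, interior Q E'.
  by apply: open_nbhs_nbhs; split=> //; exact: open_interior.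
apply: filterS iE => E' intE'.
have := norm_pairing (beta_of A E' - beta_of A E) (E' - E).
have := entropy_at_le (beta_of A E) intE'; have := entropy_at_le (beta_of A E') intE.
rewrite !entropy_atE// pairingBl !pairingBr.
set N := n%:R * _ * _; rewrite !ler_norml; lra.
Qed.

Lemma beta_of_smooth : smooth_on (interior Q) (beta_of A).
Proof.
apply: (smooth_inverse (f := mean)).
- exact: open_interior.
- exact: mean_energy_smooth.
- exact: derive_mean_energy_inj.
- exact: mean_energy_beta.
- exact: beta_of_continuous.
Qed.

(** * Concavity and Legendre duality *)

Lemma ln_partition_fun_concave :
  concave_on [set: 'rV[R]_n] (fun b => - ln (partition_fun A b)).
Proof.
apply: concave_onP; first by move=> x y l _ _; rewrite inE.
move=> x y l _ _ l0 l1; set b := l *: x + _.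
(* The tangent plane of [F] at the intermediate point [b] lies below [F] at [x] and at [y];
   averaging the two inequalities gives convexity of [F]. *)
have := gibbs_ineq b x; have := gibbs_ineq b y.
have : pairing b (mean b) = l * pairing x (mean b) + (1 - l) * pairing y (mean b).
  by rewrite {1}/b pairingDl !pairingZl.
move: (pairing x _) (pairing y _) (pairing b _) (F x) (F y) (F b).
by move=> ? ? ? ? ? ? ->; nra.
Qed.

Lemma entropy_at_concave : concave_on (interior Q) (entropy_at A).
Proof.
apply: concave_onP; first exact: interior_convex.
move=> x y l intx inty l0 l1.
have := (convex_setP _).1 (@interior_convex _ _ A) x y l intx inty l0 l1.
set z := l *: x + _ => intz; rewrite [entropy_at A z]entropy_atE//.
have := entropy_at_le (beta_of A z) intx; have := entropy_at_le (beta_of A z) inty.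
have -> : pairing (beta_of A z) z =
    l * pairing (beta_of A z) x + (1 - l) * pairing (beta_of A z) y.
  by rewrite {2}/z pairingDr !pairingZr.
move: (pairing _ x) (pairing _ y) (entropy_at A x) (entropy_at A y) (ln _).
by move=> ? ? ? ? ?; nra.
Qed.

Lemma entropy_at_legendre E : interior Q E ->
  (entropy_at A E)%:E = concave_legendre (fun x b => pairing b x)
    [set: 'rV[R]_n] (fun b => - ln (partition_fun A b)) E.
Proof.
move=> intE; apply/le_anti/andP; split.
  by apply: le_ereal_inf_tmp => _ [c _ <-]; rewrite lee_fin opprK entropy_at_le.
(* The infimum is attained at the parameter whose mean energy is [E]. *)
apply: ereal_inf_lbound; exists (beta_of A E) => //.
by rewrite opprK entropy_atE.
Qed.

Lemma ln_partition_fun_legendre b :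
  (- ln (partition_fun A b))%:E =
  concave_legendre pairing (interior Q) (entropy_at A) b.
Proof.
apply/le_anti/andP; split.
  apply: le_ereal_inf_tmp => _ [E intE <-]; rewrite lee_fin.
  by have := entropy_at_le b intE; lra.
(* Here it is attained at the mean energy of [b], an interior point whose parameter is [b]
   itself. *)
apply: ereal_inf_lbound; exists (mean b); first exact: mean_energy_interior.
rewrite entropy_atE; last exact: mean_energy_interior.
by rewrite beta_mean_energy opprD addrA subrr sub0r.
Qed.

End GibbsDistribution.

Theorem proposition2p3 (R : realType) (n : nat) (A : {fset 'cV[R]_n})
  (intQ : interior (polytope A) !=set0) :
  (forall b : 'rV[R]_n,
     has_dual_gradient (fun c => ln (partition_fun A c)) b
       (- mean_energy A b)) /\
  diffeomorphism [set: 'rV[R]_n] (interior (polytope A)) (mean_energy A) /\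
  (forall E : 'cV[R]_n, interior (polytope A) E ->
     (exists! b : 'rV[R]_n, mean_energy A b = E) /\
     constrained E (gibbs A (beta_of A E)) /\
     (forall p : A -> R, constrained E p ->
        entropy p <= entropy (gibbs A (beta_of A E)))) /\
  (forall E : 'cV[R]_n, interior (polytope A) E ->
     has_gradient (entropy_at A) E (beta_of A E)) /\
  concave_on [set: 'rV[R]_n] (fun b => - ln (partition_fun A b)) /\
  concave_on (interior (polytope A)) (entropy_at A) /\
  (forall E : 'cV[R]_n, interior (polytope A) E ->
     (entropy_at A E)%:E =
     concave_legendre (fun x b => pairing b x) [set: 'rV[R]_n]
       (fun b => - ln (partition_fun A b)) E) /\
  (forall b : 'rV[R]_n,
     (- ln (partition_fun A b))%:E =
     concave_legendre pairing (interior (polytope A)) (entropy_at A) b).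
Proof.
split; first exact: ln_partition_fun_gradient.
split.
  split; last 1 first.
  - exists (beta_of A); last exact: beta_of_smooth.
    by move=> b _; exact: beta_mean_energy.
  - split=> [b _|b c _ _|E intE]; first exact: mean_energy_interior.
      exact: mean_energy_inj.
    by have [b <-] := mean_energy_surj intQ intE; exists b.
  - exact: mean_energy_smooth.
split.
  move=> E intE; have mE := mean_energy_beta intQ intE; split; last split.
  - exists (beta_of A E); split=> // b <-; exact: beta_mean_energy.
  - by rewrite -{1}mE; exact: gibbs_constrained.
  - by rewrite -{1}mE => p; exact: entropy_le.
split; first by move=> E; exact: entropy_at_gradient.
split; first exact: ln_partition_fun_concave.
split; first exact: entropy_at_concave.
split; first by move=> E; exact: entropy_at_legendre.
exact: ln_partition_fun_legendre.
Qed.
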